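(* Let $Q$ be a quiver with cycles which is fully compatible, covered and has enough cuts. Then the set of all cuts of $Q$ is transitive under successive cut-mutations.
   Context: All quivers are finite and connected. A quiver with cycles is a triple $Q=(Q_0,Q_1,Q_2)$ where $(Q_0,Q_1)$ is a quiver and $Q_2$ is a set of cycles (paths starting and ending at the same vertex) in it. A walk is a path in the doubled quiver obtained by adding for each $\alpha:i\to j$ in $Q_1$ an arrow $\alpha^{-1}:j\to i$; a cyclic walk starts and ends at the same vertex. For $C\subseteq Q_1$ let $g_C(\alpha)=1$ if $\alpha\in C$, $g_C(\alpha)=0$ if $\alpha\in Q_1\setminus C$, $g_C(\alpha^{-1})=-g_C(\alpha)$, extended additively to paths and walks. $C$ is a cut if $g_C(c)=1$ for all $c\in Q_2$. Two cuts $C,C'$ are compatible ($C\sim C'$) if $g_C(p)=g_{C'}(p)$ for every cyclic walk $p$. $Q$ is fully compatible if all cuts are compatible with each other; covered if every arrow in $Q_1$ appears in a cycle in $Q_2$; and has enough cuts if each arrow is contained in a cut. Cut-mutation: a vertex $x$ is a strict source of $(Q,C)$ if all arrows ending at $x$ belong to $C$ and no arrow starting at $x$ belongs to $C$; then $\mu_x^+(C)$ is obtained from $C$ by removing all arrows ending at $x$ and adding all arrows starting at $x$. Dually, $x$ is a strict sink if all arrows starting at $x$ belong to $C$ and no arrow ending at $x$ belongs to $C$; then $\mu_x^-(C)$ is obtained from $C$ by removing all arrows starting at $x$ and adding all arrows ending at $x$. The operations $\mu_x^\pm$ are called cut-mutations. Transitivity means that any cut can be obtained from any other cut by a finite sequence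 of cut-mutations.
   Formalization: It is additionally assumed that no cycle in Q_2 consists of a single loop; without this the statement fails, e.g. for two vertices x, y with a loop at each, arrows b from x to y and c from y to x, and Q_2 consisting of the two loops and bc. *)

(* Defs.v *)
From HB Require Import structures.
From mathcomp Require Import all_boot all_order all_algebra.

Set Implicit Arguments.
Unset Strict Implicit.
Unset Printing Implicit Defensive.

Import GRing.Theory.
Local Open Scope ring_scope.

Record quiver := Quiver {
  vertex : finType;
  arrow : finType;
  source : arrow -> vertex;
  target : arrow -> vertex
}.

(* A list of arrows p is a path from x to y, read in traversal order; the
   empty list is the trivial path at x. *)
Fixpoint is_path (Q : quiver) (x : vertex Q) (p : seq (arrow Q))
    (y : vertex Q) : bool :=
  if p is a :: p' then (source a == x) && is_path (target a) p' y else x == y.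

(* [inl a] is the arrow a, and [inr a] is its formal inverse. *)
Definition doubled (Q : quiver) : quiver :=
  @Quiver (vertex Q) (arrow Q + arrow Q)%type
    (fun b => match b with inl a => source a | inr a => target a end)
    (fun b => match b with inl a => target a | inr a => source a end).

Definition is_walk (Q : quiver) (x : vertex Q) (w : seq (arrow (doubled Q)))
    (y : vertex Q) : bool :=
  @is_path (doubled Q) x w y.

Definition quiver_connected (Q : quiver) : Prop :=
  forall x y : vertex Q, exists w, is_walk x w y.

(* The base vertex x in [cycles x c] is determined by c except for trivial
   paths.  The set of cycles is not assumed to be finite, nor to be stable
   under rotation of cycles. *)
Record quiver_with_cycles := QuiverWithCycles {
  qwc_quiver :> quiver;
  cycles : vertex qwc_quiver -> seq (arrow qwc_quiver) -> Prop;
  cyclesP : forall x c, cycles x c -> is_path x c x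
}.

Definition g_arrow (Q : quiver) (C : {set arrow Q}) (a : arrow Q) : int :=
  if a \in C then 1 else 0.

Definition g_path (Q : quiver) (C : {set arrow Q}) (p : seq (arrow Q)) : int :=
  \sum_(a <- p) g_arrow C a.

Definition g_step (Q : quiver) (C : {set arrow Q}) (b : arrow (doubled Q)) :
    int :=
  match b with inl a => g_arrow C a | inr a => - g_arrow C a end.

Definition g_walk (Q : quiver) (C : {set arrow Q})
    (w : seq (arrow (doubled Q))) : int :=
  \sum_(b <- w) g_step C b.

Definition is_cut (Q : quiver_with_cycles) (C : {set arrow Q}) : Prop :=
  forall x c, cycles x c -> g_path C c = 1.

Definition compatible (Q : quiver) (C C' : {set arrow Q}) : Prop :=
  forall x w, is_walk x w x -> g_walk C w = g_walk C' w.

Definition fully_compatible (Q : quiver_with_cycles) : Prop :=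
  forall C C' : {set arrow Q}, is_cut C -> is_cut C' -> compatible C C'.

Definition covered (Q : quiver_with_cycles) : Prop :=
  forall a : arrow Q, exists x c, cycles x c /\ a \in c.

Definition has_enough_cuts (Q : quiver_with_cycles) : Prop :=
  forall a : arrow Q, exists2 C : {set arrow Q}, is_cut C & a \in C.

(* No element of the distinguished set of cycles is a single loop.  Without
   this, transitivity fails: take two vertices x and y, a loop at each of them,
   arrows b : x -> y and c : y -> x, and as cycles the two loops and bc.  This
   has two cuts (the loops with b, and the loops with c), but no strict sources
   or sinks, since a loop both starts and ends at its vertex.  Loops are still
   allowed as arrows of the quiver. *)
Definition no_loop_cycles (Q : quiver_with_cycles) : Prop :=
  forall (x : vertex Q) c, cycles x c -> size c <> 1%N.

Definition in_arrows (Q : quiver) (x : vertex Q) : {set arrow Q} :=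
  [set a | target a == x].

Definition out_arrows (Q : quiver) (x : vertex Q) : {set arrow Q} :=
  [set a | source a == x].

Definition strict_source (Q : quiver) (C : {set arrow Q}) (x : vertex Q) :
    bool :=
  (in_arrows x \subset C) && [disjoint out_arrows x & C].

Definition strict_sink (Q : quiver) (C : {set arrow Q}) (x : vertex Q) : bool :=
  (out_arrows x \subset C) && [disjoint in_arrows x & C].

Definition mu_plus (Q : quiver) (x : vertex Q) (C : {set arrow Q}) :
    {set arrow Q} :=
  (C :\: in_arrows x) :|: out_arrows x.

Definition mu_minus (Q : quiver) (x : vertex Q) (C : {set arrow Q}) :
    {set arrow Q} :=
  (C :\: out_arrows x) :|: in_arrows x.

Definition cut_mutation (Q : quiver) : rel {set arrow Q} :=
  fun C C' => [exists x : vertex Q,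
    (strict_source C x && (C' == mu_plus x C))
    || (strict_sink C x && (C' == mu_minus x C))].

(* The intermediate sets need not be required to be cuts: a mutation at a
   strict source or sink preserves the value of g on every cyclic path, so it
   takes cuts to cuts. *)
Definition cuts_transitive (Q : quiver_with_cycles) : Prop :=
  forall C C' : {set arrow Q}, is_cut C -> is_cut C' ->
    connect (@cut_mutation Q) C C'.

(* Main.v *)
Require Import Defs.
From mathcomp Require Import all_boot all_order all_algebra.
From mathcomp Require Import zify ring.

(**
  Two compatible cuts C, C' differ by a coboundary: g_C - g_C' = dh for a
  function h on the vertices, which can be taken with values in nat.  Mutating
  C at a strict source x lowers h by 1 at x only, so it suffices to find a
  strict source with h(x) > 0 and to induct on the sum of h.

  Orient each arrow outside C forwards and each arrow in C backwards; the strict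
  sources are then the vertices without incoming edges.  This orientation has
  no directed cycle w: a cut C'' satisfies g_C <= g_C'' at each step of w, and
  g_C(w) = g_C''(w) by compatibility, so all cuts agree along w.  Thus an arrow
  of w would be in no cut, or in all cuts; the former contradicts having enough
  cuts, and so does the latter, applied to another arrow of a distinguished
  cycle through it.  Hence the set of vertices where h is maximal has a vertex
  without incoming edges from that set, and no edge enters the set from
  outside.
*)

Set Implicit Arguments.
Unset Strict Implicit.
Unset Printing Implicit Defensive.

Import Order.TTheory GRing.Theory Num.Theory.
Local Open Scope ring_scope.

Lemma is_path_cat (Q : quiver) (x y z : vertex Q) p q :
  is_path x p y -> is_path y q z -> is_path x (p ++ q) z.
Proof.
by elim: p x => [|a p IHp] x /= => [/eqP-> //|/andP[-> /IHp h] /h].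
Qed.

Lemma g_walk_cat (Q : quiver) (C : {set arrow Q}) w1 w2 :
  g_walk C (w1 ++ w2) = g_walk C w1 + g_walk C w2.
Proof. exact: big_cat. Qed.

Lemma g_arrow_ge0 (Q : quiver) (C : {set arrow Q}) a : 0 <= g_arrow C a.
Proof. by rewrite /g_arrow; case: ifP. Qed.

Lemma g_arrow_inj (Q : quiver) (C C' : {set arrow Q}) :
  g_arrow C =1 g_arrow C' -> C = C'.
Proof.
move=> e; apply/setP => a; move: (e a).
by rewrite /g_arrow; do 2!case: (a \in _).
Qed.

Definition is_potential (Q : quiver) (C C' : {set arrow Q})
    (h : vertex Q -> nat) : Prop :=
  forall a, g_arrow C a - g_arrow C' a = (h (target a))%:Z - (h (source a))%:Z.

Lemma compatible_potential (Q : quiver) (C C' : {set arrow Q}) :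
  quiver_connected Q -> compatible C C' -> exists h, is_potential C C' h.
Proof.
move=> conn comp.
have [x0 _ | no_vertex] := pickP (@predT (vertex Q)); last first.
  by exists (fun=> 0%N) => a; have := no_vertex (source a).
pose d w : int := g_walk C w - g_walk C' w.
(* [d] vanishes on cyclic walks, so the chosen walk does not matter; [K] shifts the values into
   nat. *)
pose h0 y : int := d (xchoose (conn x0 y)).
pose K : nat := (\sum_y `|h0 y|)%N.
have h0K y : 0 <= h0 y + K%:Z.
  by rewrite /K (bigD1 y) //=; lia.
exists (fun y => absz (h0 y + K%:Z)%R) => a.
rewrite !gez0_abs //.
suff: d [:: inl a] = h0 (target a) - h0 (source a).
  by rewrite /d /g_walk !big_seq1 /=; lia.
(* The chosen walks to the two ends of [a] both close up through [v], one of them after [a];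
   subtracting cancels [d v]. *)
have [v vP] := conn (target a) x0.
have cyc1 := comp x0 _ (is_path_cat (xchooseP (conn x0 (target a))) vP).
have aP : is_walk (source a) (inl a :: v) x0 by rewrite /is_walk /= eqxx.
have cyc2 := comp x0 _ (is_path_cat (xchooseP (conn x0 (source a))) aP).
move: cyc1 cyc2; rewrite -(cat1s (inl a) v) /h0 /d !g_walk_cat; lia.
Qed.

Lemma g_arrow_mu_plus (Q : quiver) (C : {set arrow Q}) x a :
  strict_source C x ->
  g_arrow (mu_plus x C) a
  = g_arrow C a + (source a == x)%:Z - (target a == x)%:Z.
Proof.
case/andP => /subsetP/(_ a) + /pred0P/(_ a) /=.
rewrite /g_arrow !inE.
case: (source a == x); case: (target a == x); case: (a \in C) => //= H //.
all: by have := H isT.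
Qed.

Lemma g_path_mu_plus (Q : quiver) (C : {set arrow Q}) x y z p :
  strict_source C x -> is_path y p z ->
  g_path (mu_plus x C) p = g_path C p + (y == x)%:Z - (z == x)%:Z.
Proof.
rewrite /g_path => srcx; elim: p y => [|a p IHp] y /=.
  by move=> /eqP->; rewrite !big_nil; lia.
case/andP => /eqP<- /IHp e.
by rewrite !big_cons e g_arrow_mu_plus //; ring.
Qed.

Lemma is_cut_mu_plus (Q : quiver_with_cycles) (C : {set arrow Q}) x :
  strict_source C x -> is_cut C -> is_cut (mu_plus x C).
Proof.
move=> srcx cutC y c cyc.
by rewrite (g_path_mu_plus srcx (cyclesP cyc)) (cutC y c cyc); lia.
Qed.

Definition cut_oriented (Q : quiver) (C : {set arrow Q})
    (b : arrow (doubled Q)) : bool :=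
  match b with inl a => a \notin C | inr a => a \in C end.

(** Oriented steps take the least possible value: 0 on an arrow, -1 on an inverse. *)
Lemma g_step_cut_oriented (Q : quiver) (C C' : {set arrow Q}) b :
  cut_oriented C b -> g_step C b <= g_step C' b.
Proof.
by case: b => a; rewrite /= /g_arrow; case: (a \in C) (a \in C') => [] [].
Qed.

Section CutOrientation.

Variable Q : quiver_with_cycles.
Hypotheses (Q_no_loop_cycles : no_loop_cycles Q)
  (Q_compatible : fully_compatible Q) (Q_covered : covered Q)
  (Q_cuts : has_enough_cuts Q).

Lemma not_in_all_cuts (a : arrow Q) :
  ~ (forall C : {set arrow Q}, is_cut C -> a \in C).
Proof.
move=> all_a; have [x [c [cyc ac]]] := Q_covered a.
(* The rest of [c] is nonempty as [c] is not a loop. Even if [a'] equals [a], a cut containing both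
   entries has value at least 2 on [c]. *)
have := perm_to_rem ac; case: (rem a c) => [|a' r] perm_c.
  by have := Q_no_loop_cycles cyc; rewrite (perm_size perm_c).
have [C cutC a'C] := Q_cuts a'.
have := cutC x c cyc; rewrite /g_path (perm_big _ perm_c) /= !big_cons.
rewrite {1 2}/g_arrow (all_a C cutC) a'C.
set s := \sum_(j <- r) _.
have : 0 <= s by apply: sumr_ge0 => j _; exact: g_arrow_ge0.
lia.
Qed.

Lemma cut_oriented_acyclic (C : {set arrow Q}) x w :
  is_cut C -> is_walk x w x -> all (cut_oriented C) w -> w = [::].
Proof.
move=> cutC walk_w /allP w_or.
have agree C' b : is_cut C' -> b \in w -> g_step C b = g_step C' b.
  move=> cutC' bw; have := Q_compatible cutC cutC' walk_w.
  (* Nonnegative differences with sum zero all vanish. *)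
  rewrite /g_walk => /esym/eqP; rewrite -subr_eq0 -sumrB big_seq psumr_eq0.
    by move=> /allP/(_ b bw); rewrite bw subr_eq0 => /eqP.
  by move=> i /w_or iw; rewrite subr_ge0 g_step_cut_oriented.
case: w w_or agree {walk_w} => // b w /(_ b (mem_head _ _)) b_or agree.
case: b b_or agree => a /= aC agree.
  have [C' cutC' aC'] := Q_cuts a.
  have := agree C' (inl a) cutC' (mem_head _ _).
  by rewrite /= /g_arrow (negbTE aC) aC'.
case: (@not_in_all_cuts a) => C' cutC'.
have := agree C' (inr a) cutC' (mem_head _ _).
by rewrite /= /g_arrow aC; case: (a \in C').
Qed.

(** Otherwise one could go backwards along edges inside [P] forever, and by finiteness close a
    directed cycle. *)
Lemma cut_oriented_initial (C : {set arrow Q}) (P : pred (vertex Q)) x0 :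
  is_cut C -> P x0 ->
  exists2 x, P x & forall b : arrow (doubled Q),
    target b = x -> cut_oriented C b -> ~~ P (source b).
Proof.
move=> cutC Px0.
pose into x (b : arrow (doubled Q)) :=
  [&& target b == x :> vertex Q, cut_oriented C b & P (source b)].
have [x /andP[Px no_b] | has_b] :=
    pickP [pred x | P x && [forall b, ~~ into x b]].
  exists x => // b tb orb; have /forallP/(_ b) := no_b.
  by rewrite /into tb eqxx orb.
(* The default [x] is never reached on [P], by [fP]. *)
pose f x : vertex Q := if [pick b | into x b] is Some b then source b else x.
have fP x : P x -> exists2 b, into x b & f x = source b.
  move=> Px; rewrite /f; case: pickP => [b|none]; first by exists b.
  have := has_b x; rewrite /= Px => /negbT/negP[].
  by apply/forallP => b; rewrite none.
have Pf n : P (iter n f x0).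
  by elim: n => //= n /fP[b /and3P[_ _ ?] ->].
have walk_f n k : exists w, [/\ size w = k, all (cut_oriented C) w
    & is_walk (iter (k + n) f x0) w (iter n f x0)].
  elim: k => [|k [w [sz orw walk_w]]].
    by exists [::]; split; rewrite // /is_walk /= eqxx.
  have [b /and3P[/eqP tb orb _] fb] := fP _ (Pf (k + n)%N).
  exists (b :: w); split; rewrite /= ?sz ?orb //.
  by rewrite fb /is_walk /= eqxx; move: walk_w; rewrite /is_walk -tb.
(* The orbit returns to an index [i < order f x0], so the cycle has positive length. *)
have /trajectP[i lt_i eq_i] := looping_order f x0.
have [w [sz orw]] := walk_f i (order f x0 - i)%N.
rewrite subnK ?(ltnW lt_i) // eq_i => walk_w.
by move: sz; rewrite (cut_oriented_acyclic cutC walk_w orw) /=; lia.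
Qed.

Lemma potential_strict_source (C C' : {set arrow Q}) (h : vertex Q -> nat) y :
  is_cut C -> is_potential C C' h -> (0 < h y)%N ->
  exists2 x, strict_source C x & (0 < h x)%N.
Proof.
move=> cutC pot hy.
case: (arg_maxnP h (isT : predT y)) => m _ max_h.
have max_m z : (h z <= h m)%N := max_h z isT.
have [x /eqP hx init] :=
  cut_oriented_initial (P := fun x => h x == h m) cutC (eqxx (h m)).
exists x; last by rewrite hx; exact: leq_trans hy (max_m y).
apply/andP; split.
  (* Outside [C], [a] would give [h (source a) >= h x], so its source would also be maximal, against
     [init]. *)
  apply/subsetP => a; rewrite inE => /eqP ta; apply: contraT => aC.
  have /= := init (inl a) ta aC; have := max_m (source a).
  have := pot a; have := g_arrow_ge0 C' a.
  by rewrite {2}/g_arrow (negbTE aC) ta hx /=; lia.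
rewrite disjoint_subset; apply/subsetP => a; rewrite !inE => /eqP sa.
apply/negP => aC; have /= := init (inr a) sa aC; have := max_m (target a).
have := pot a; rewrite sa hx /g_arrow aC; case: ifP => _ /=; lia.
Qed.

Lemma potential_connect (C C' : {set arrow Q}) (h : vertex Q -> nat) :
  is_cut C -> is_potential C C' h -> connect (@cut_mutation Q) C C'.
Proof.
have [n] := ubnP (\sum_x h x)%N.
elim: n C h => // n IHn C h le_n cutC pot.
have [y hy | h0] := pickP (fun y => 0 < h y)%N; last first.
  have -> : C = C' by apply: g_arrow_inj => a; have := pot a;
    have := h0 (source a); have := h0 (target a); lia.
  exact: connect0.
have [x srcx hx] := potential_strict_source cutC pot hy.
apply: (connect_trans (y := mu_plus x C)).
  by apply/connect1/existsP; exists x; rewrite srcx eqxx.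
apply: (IHn _ (fun z => h z - (z == x))%N); last 2 first.
- exact: is_cut_mu_plus.
- move=> a; rewrite g_arrow_mu_plus //; have := pot a.
  (* This makes the truncated subtraction exact. *)
  have pos z : ((z == x) <= h z)%N by case: eqP => // ->.
  by have := pos (source a); have := pos (target a); lia.
move: le_n; rewrite (bigD1 x) //= [X in (X < n)%N](bigD1 x) //= eqxx.
rewrite [X in (_ + X < n)%N](eq_bigr h); first by lia.
by move=> i /negbTE->; rewrite subn0.
Qed.

End CutOrientation.

Theorem theorem3p11 (Q : quiver_with_cycles)
  (Q_connected : quiver_connected Q)
  (Q_no_loop_cycles : no_loop_cycles Q)
  (Q_compatible : fully_compatible Q)
  (Q_covered : covered Q)
  (Q_cuts : has_enough_cuts Q) :
  cuts_transitive Q.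
Proof.
move=> C C' cutC cutC'.
have [h pot] := compatible_potential Q_connected (Q_compatible C C' cutC cutC').
exact: (potential_connect _ _ _ _ cutC pot).
Qed.
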